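(* Let $p\geq 2$ be a prime and let $\mathbf{k}$ be a field of characteristic $p$ (so $\mathbb{F}_p\subseteq\mathbf{k}$). Then the polynomial $\mathcal{I}_p\in\mathbb{F}_p[f,g,\alpha_1,\alpha_2,t]\subseteq \mathbf{k}(f,g,\alpha_1,\alpha_2,t)$ is a simultaneous integral of motion of $T_1$, $T_2$ and $D_t$, i.e. $$T_1(\mathcal{I}_p)=T_2(\mathcal{I}_p)=\mathcal{I}_p,\qquad D_t\mathcal{I}_p=0.$$ Moreover $\mathcal{I}_p$ has total degree $3p$ and bi-degree $(2p,2p)$ in $(f,g)$, and $$\mathcal{I}_p=-f^{2p}g^p+f^pg^{2p}+O(f,g)$$ for a polynomial $O(f,g)\in\mathbb{F}_p[f,g,\alpha_1,\alpha_2,t]$ of degree less than $2p$ in $f$ and degree less than $2p$ in $g$.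
   Context: Let $\mathbf{k}$ be a field of characteristic $p$. On the rational function field $\mathbf{k}(f,g,\alpha_1,\alpha_2,t)$ let $D_t$ be the $\mathbf{k}$-linear derivation with $D_t f=f(2g-f-t)-\alpha_1$, $D_t g=g(2f-g+t)+\alpha_2$, $D_t\alpha_1=D_t\alpha_2=0$, $D_t t=1$ (the fourth Painlevé equation). Let $T_1,T_2$ be the $\mathbf{k}$-linear field automorphisms given by $T_1:(f,g,\alpha_1,\alpha_2,t)\mapsto(\bar f^1,\bar g^1,\alpha_1+1,\alpha_2,t)$ and $T_2:(f,g,\alpha_1,\alpha_2,t)\mapsto(\bar f^2,\bar g^2,\alpha_1,\alpha_2+1,t)$, where $\bar f^1=\frac{(\alpha_1+\alpha_2)f}{\alpha_1-fg}-f+g-t-\frac{\alpha_1}{f}$, $\bar g^1=\frac{(\alpha_2+fg)f}{\alpha_1-fg}$, $\bar g^2=\frac{(\alpha_1+\alpha_2)g}{\alpha_2+fg}+f-g+t+\frac{\alpha_2}{g}$, $\bar f^2=\frac{(\alpha_1-fg)g}{\alpha_2+fg}$ (the difference second Painlevé equation). Define the $2\times2$ matrix polynomial in $z$ with coefficients in $\mathbb{Z}[f,g,\alpha_1,\alpha_2,t,w,w^{-1}]$: $$A(z)=\begin{bmatrix}w&0\\0&1\end{bmatrix}\begin{bmatrix}1&0\\ f-tfg-tz&1\end{bmatrix}\begin{bmatrix}g&1\\ z+\alpha_2&0\end{bmatrix}\begin{bmatrix}-f&1\\ z&0\end{bmatrix}\begin{bmatrix}tz-g+tfg&1\\ z-\alpha_1&0\end{bmatrix}\begin{bmatrix}w^{-1}&0\\0&1\end{bmatrix}.$$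 Define $\mathcal{I}_p:=\operatorname{Tr}[A(p-1)A(p-2)\cdots A(1)A(0)]$ computed in characteristic $p$; it is an element of $\mathbb{F}_p[f,g,\alpha_1,\alpha_2,t]$ (independent of $w$). *)

(* Defs.v *)
From HB Require Import structures.
From mathcomp Require Import all_boot all_order all_algebra.
From mathcomp Require Import fraction mpoly.
Set Implicit Arguments. Unset Strict Implicit. Unset Printing Implicit Defensive.
Import Order.TTheory GRing.Theory.
Local Open Scope ring_scope.

Notation "x %:F" := (@FracField.tofrac _ x) (format "x %:F") : ring_scope.

Definition vf : 'I_5 := @Ordinal 5 0 isT.
Definition vg : 'I_5 := @Ordinal 5 1 isT.
Definition va1 : 'I_5 := @Ordinal 5 2 isT.
Definition va2 : 'I_5 := @Ordinal 5 3 isT.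
Definition vt : 'I_5 := @Ordinal 5 4 isT.

Definition mx2 (R : Type) (a b c d : R) : 'M[R]_2 :=
  \matrix_(i < 2, j < 2)
    if (i : nat) == 0%N then (if (j : nat) == 0%N then a else b)
    else (if (j : nat) == 0%N then c else d).

Section Lax.
Variable R : comRingType.
Local Notation P := {mpoly R[5]}.
Local Notation f := ('X_vf : P).
Local Notation g := ('X_vg : P).
Local Notation a1 := ('X_va1 : P).
Local Notation a2 := ('X_va2 : P).
Local Notation t := ('X_vt : P).

(* The matrix A(z) of the paper, with the conjugation by diag(w,1) omitted
   (it does not affect the trace of the product). *)
Definition Amat (z : P) : 'M[P]_2 :=
  mx2 1 0 (f - t * f * g - t * z) 1
  *m mx2 g 1 (z + a2) 0
  *m mx2 (- f) 1 z 0
  *m mx2 (t * z - g + t * f * g) 1 (z - a1) 0.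

Definition Ipoly (p : nat) : P :=
  \tr (\prod_(i < p) Amat ((p.-1 - i)%N%:R)).
End Lax.

Definition Ip (p : nat) : {mpoly 'F_p[5]} := Ipoly 'F_p p.

(* The canonical map F_p -> k (a ring map when p is the characteristic of k) *)
Definition Fp_to (k : fieldType) (p : nat) (x : 'F_p) : k := (nat_of_ord x)%:R.

Definition degvar (R : ringType) (n : nat) (i : 'I_n) (Q : {mpoly R[n]}) : nat :=
  (\max_(m <- msupp Q) m i)%N.

Section Maps.
Variable k : fieldType.
Local Notation P := {mpoly k[5]}.
Local Notation F := {fraction P}.
Local Notation X i := (('X_i : P)%:F : F).

(* Evaluation of a polynomial of k[f,g,a1,a2,t] at a 5-tuple of elements of
   k(f,g,a1,a2,t): this is how a k-linear field automorphism acts on polynomials. *)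
Definition subst (v : 'I_5 -> F) (Q : P) : F := mmap (fun c : k => (c%:MP)%:F) v Q.

Definition T1v (i : 'I_5) : F :=
  let f := X vf in let g := X vg in let a1 := X va1 in let a2 := X va2 in
  let t := X vt in
  if i == vf then (a1 + a2) * f / (a1 - f * g) - f + g - t - a1 / f
  else if i == vg then (a2 + f * g) * f / (a1 - f * g)
  else if i == va1 then a1 + 1
  else if i == va2 then a2
  else t.

Definition T2v (i : 'I_5) : F :=
  let f := X vf in let g := X vg in let a1 := X va1 in let a2 := X va2 in
  let t := X vt in
  if i == vf then (a1 - f * g) * g / (a2 + f * g)
  else if i == vg then (a1 + a2) * g / (a2 + f * g) + f - g + t + a2 / g
  else if i == va1 then a1
  else if i == va2 then a2 + 1
  else t.

Definition T1 (Q : P) : F := subst T1v Q.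
Definition T2 (Q : P) : F := subst T2v Q.

Definition Dv (i : 'I_5) : P :=
  let f := ('X_vf : P) in let g := ('X_vg : P) in let a1 := ('X_va1 : P) in
  let a2 := ('X_va2 : P) in let t := ('X_vt : P) in
  if i == vf then f * (2%:R * g - f - t) - a1
  else if i == vg then g * (2%:R * f - g + t) + a2
  else if i == vt then 1
  else 0.

(* The k-linear derivation D_t restricted to k[f,g,a1,a2,t] (chain rule). *)
Definition Dt (Q : P) : P := \sum_(i < 5) Q^`M(i) * Dv i.
End Maps.

(* Main.v *)
(** The gauge factor [[1,0],[t(z-1+fg),1]] is p-periodic in z and turns A(z)
    into C(z) = [[1,0],[f,1]] [[g,1],[z+b,0]] [[-f,1],[z,0]] [[t-g,1],[z-a,0]],
    where a, b stand for alpha_1, alpha_2.  T1 and T2 come from moving the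
    factor of C containing a, resp. b, across the product: with f', g' the
    images of f, g, there is a matrix R(z) linear in z, with
    C(z) R(z) = R(z+1) C'(z) (for T2, R(z+1) C(z) = C'(z) R(z)).  Since R(p) = R(0)
    and R(0) is invertible over the function field, the monodromy matrices
    C(p-1) ... C(0) and C'(p-1) ... C'(0) are conjugate.  In the same way
    D_t C(z) = M(z+1) C(z) - C(z) M(z) makes the t-derivative of the monodromy
    matrix a commutator with M(0), hence traceless.  For the leading terms, the
    degree in f (resp. g) of the (i,l) entry of C is at most A_i + B_l, and
    A_l + B_l attains its maximum 2 at a single l, so only the p-th power of
    the l-th diagonal entry contributes to the top degree of the trace. *)

Require Import Defs.
From HB Require Import structures.
From mathcomp Require Import all_boot all_order all_algebra.
From mathcomp Require Import fraction mpoly.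
From mathcomp Require Import ring zify.
Import GRing.Theory.
Set Implicit Arguments.
Unset Strict Implicit.
Unset Printing Implicit Defensive.
Local Open Scope ring_scope.

(** * Arithmetic of two-by-two matrices *)

Section Mx2.
Variable R : comNzRingType.

Lemma mul_mx2 (a b c d a' b' c' d' : R) :
  mx2 a b c d *m mx2 a' b' c' d' =
  mx2 (a * a' + b * c') (a * b' + b * d') (c * a' + d * c') (c * b' + d * d').
Proof.
by apply/matrixP => i j; rewrite !mxE !big_ord_recl big_ord0 !mxE /= addr0;
   case: ifP => _; case: ifP.
Qed.

Lemma det_mx2 (a b c d : R) : \det (mx2 a b c d) = a * d - b * c.
Proof.
rewrite (expand_det_row _ ord0) !big_ord_recl big_ord0 /cofactor !det_mx11.
by rewrite !mxE /=; ring.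
Qed.

Lemma map_mx2 (S : Type) (h : R -> S) (a b c d : R) :
  map_mx h (mx2 a b c d) = mx2 (h a) (h b) (h c) (h d).
Proof. by apply/matrixP => i j; rewrite !mxE; do !case: ifP. Qed.

Lemma add_mx2 (a b c d a' b' c' d' : R) :
  mx2 a b c d + mx2 a' b' c' d' = mx2 (a + a') (b + b') (c + c') (d + d').
Proof. by apply/matrixP => i j; rewrite !mxE; do !case: ifP. Qed.

Lemma opp_mx2 (a b c d : R) :
  - mx2 a b c d = mx2 (- a) (- b) (- c) (- d).
Proof. by apply/matrixP => i j; rewrite !mxE; do !case: ifP. Qed.

End Mx2.

(** * Ordered products and their intertwiners *)

Section DescendingProducts.
Variables (R : comNzRingType) (m : nat).
Implicit Types A B U : nat -> 'M[R]_m.+1.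

Definition dprod A n : 'M[R]_m.+1 := \prod_(i < n) A (n.-1 - i)%N.

Lemma dprod0 A : dprod A 0 = 1.
Proof. exact: big_ord0. Qed.

Lemma dprodS A n : dprod A n.+1 = A n * dprod A n.
Proof.
rewrite /dprod big_ord_recl /= subn0; congr (_ * _).
by apply: eq_bigr => i _; congr A; rewrite /= /bump add1n; case: n i => [[]|].
Qed.

Lemma map_dprod (S : comNzRingType) (h : {rmorphism R -> S}) A n :
  map_mx h (dprod A n) = \prod_(i < n) map_mx h (A (n.-1 - i)%N).
Proof. by rewrite /dprod rmorph_prod. Qed.

Lemma dprod_intertwine A B U n :
  (forall j, U j.+1 * A j = B j * U j) ->
  U n * dprod A n = dprod B n * U 0%N.
Proof.
move=> UAB; elim: n => [|n IHn]; first by rewrite !dprod0 mulr1 mul1r.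
by rewrite !dprodS mulrA UAB -mulrA IHn mulrA.
Qed.

End DescendingProducts.

(* Only the regularity of [\det (U 0)] is used, so the intertwiner may be
   singular at other points of the orbit. *)
Lemma mxtrace_dprod_intertwine (R : idomainType) (m : nat)
    (A B U : nat -> 'M[R]_m.+1) n :
  (forall j, U j.+1 * A j = B j * U j) -> U n = U 0%N -> \det (U 0%N) != 0 ->
  \tr (dprod A n) = \tr (dprod B n).
Proof.
move=> UAB Un U0; have := dprod_intertwine n UAB; rewrite Un => eqU.
(* Both traces are multiplied by [\det (U 0)], so that the adjugate can serve in place of an
   inverse. *)
apply: (mulfI U0); rewrite -!mxtraceZ -!mul_scalar_mx -{1}mul_adj_mx -mulmxA.
rewrite [_ *m dprod A n]eqU mxtrace_mulC -mulmxE -mulmxA mul_mx_adj.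
by rewrite mul_mx_scalar mul_scalar_mx.
Qed.

(** * The Lax matrices and the trace of the monodromy *)

Section LaxPair.
Variable R : comNzRingType.
Implicit Types f g a b t z : R.

Definition laxA f g a b t z : 'M[R]_2 :=
  mx2 1 0 (f - t * f * g - t * z) 1 *m mx2 g 1 (z + b) 0
  *m mx2 (- f) 1 z 0 *m mx2 (t * z - g + t * f * g) 1 (z - a) 0.

Definition laxC f g a b t z : 'M[R]_2 :=
  mx2 1 0 f 1 *m mx2 g 1 (z + b) 0 *m mx2 (- f) 1 z 0
  *m mx2 (t - g) 1 (z - a) 0.

(** The expanded entries let degrees be read off monomial by monomial. *)
Lemma laxCE f g a b t z :
  laxC f g a b t z =
  mx2 (f * g ^+ 2 + (t * z - t * f * g - a * g)) (z - f * g)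
      (f ^+ 2 * g ^+ 2 - t * f ^+ 2 * g - a * f * g + f * g * z + z ^+ 2 - a * z
       + b * f * g - b * t * f + b * z - b * a)
      (- (f ^+ 2 * g) - b * f).
Proof. by rewrite /laxC !mul_mx2; congr mx2; ring. Qed.

Definition laxU f g t z : 'M[R]_2 := mx2 1 0 (t * (z - 1 + f * g)) 1.

Lemma laxU_intertwine f g a b t z :
  laxU f g t (z + 1) *m laxA f g a b t z = laxC f g a b t z *m laxU f g t z.
Proof. by rewrite /laxU /laxA /laxC !mul_mx2; congr mx2; ring. Qed.

Definition laxM f g a b t z : 'M[R]_2 :=
  mx2 t 1 (z - 1 + b - a + 2%:R * f * g) 0.

End LaxPair.

Lemma map_laxA (R S : comNzRingType) (h : {rmorphism R -> S}) (f g a b t z : R) :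
  map_mx h (laxA f g a b t z) = laxA (h f) (h g) (h a) (h b) (h t) (h z).
Proof.
by rewrite /laxA !map_mxM !map_mx2 !(rmorphB, rmorphD, rmorphN, rmorphM)
           rmorph0 rmorph1.
Qed.

(** Taken over any commutative ring, so that base change, the embedding into fractions and
    substitution are all instances of naturality. *)
Definition laxTrace {R : comNzRingType} (p : nat) (f g a b t : R) : R :=
  \tr (dprod (fun n => laxA f g a b t n%:R) p).

Lemma rmorph_laxTrace (R S : comNzRingType) (h : {rmorphism R -> S})
    (p : nat) (f g a b t : R) :
  h (laxTrace p f g a b t) = laxTrace p (h f) (h g) (h a) (h b) (h t).
Proof.
rewrite /laxTrace -trace_map_mx map_dprod; congr (\tr _).
by apply: eq_bigr => i _; rewrite map_laxA rmorph_nat.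
Qed.

Lemma laxTraceE (R : idomainType) (p : nat) (f g a b t : R) :
  p%:R = 0 :> R ->
  laxTrace p f g a b t = \tr (dprod (fun n => laxC f g a b t n%:R) p).
Proof.
move=> p0; apply: (@mxtrace_dprod_intertwine _ _ _ _ (fun n => laxU f g t n%:R)).
- by move=> j; rewrite -natr1; apply: laxU_intertwine.
- by rewrite p0.
- by rewrite /laxU det_mx2 mulr1 mul0r subr0 oner_neq0.
Qed.

(** * Invariance under the two translations *)

Section Backlund.
Variables (K : fieldType) (p : nat).
Hypothesis p0 : p%:R = 0 :> K.
Implicit Types f g a b t z : K.

Lemma laxTrace_T1 f g a b t :
  f != 0 -> a - f * g != 0 -> a + 1 != 0 ->
  laxTrace p ((a + b) * f / (a - f * g) - f + g - t - a / f)
             ((b + f * g) * f / (a - f * g)) (a + 1) b t =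
  laxTrace p f g a b t.
Proof.
move=> f0 afg a1; rewrite !laxTraceE //.
set f1 := _ - a / f; set g1 := _ / _.
(* R(a+1) has kernel (1,g1-t), the kernel of C'(a+1), and image (1,-g1), the
   image of C(a). *)
apply: (@mxtrace_dprod_intertwine _ _ _ _
  (fun n => mx2 1 0 (- g1) 1 *m mx2 (t - g1) 1 (n%:R - 1 - a) 0)).
- move=> j; rewrite -natr1 -!mulmxE /laxC !mul_mx2 /f1 /g1.
  by congr mx2; field; rewrite ?f0 ?afg.
- by rewrite p0.
(* det R(0) is the shifted parameter [a + 1]. *)
- rewrite det_mulmx !det_mx2 (_ : _ * _ = a + 1) //; ring.
Qed.

Lemma laxTrace_T2 f g a b t :
  g != 0 -> b + f * g != 0 -> b != 0 ->
  laxTrace p ((a - f * g) * g / (b + f * g))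
             ((a + b) * g / (b + f * g) + f - g + t + b / g) a (b + 1) t =
  laxTrace p f g a b t.
Proof.
move=> g0 bfg b0; rewrite !laxTraceE //; apply/esym.
set f2 := _ * g / _; set g2 := _ + b / g.
(* R(-b) has kernel (1,-t-f2), the kernel of C(-b), and image (1,f2), the line containing the image
   of C'(-b-1). *)
apply: (@mxtrace_dprod_intertwine _ _ _ _
  (fun n => mx2 1 0 f2 1 *m mx2 (t + f2) 1 (n%:R + b) 0)).
- move=> j; rewrite -natr1 -!mulmxE /laxC !mul_mx2 /f2 /g2.
  by congr mx2; field; rewrite ?g0 ?bfg.
- by rewrite p0.
- by rewrite det_mulmx !det_mx2 (_ : _ * _ = - b) ?oppr_eq0 //; ring.
Qed.

End Backlund.

(** * Vanishing derivative along the Painlevé flow *)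

Section Derivation.
Variables (R : idomainType) (D : {additive R -> R}).
Hypothesis DM : forall x y, D (x * y) = D x * y + x * D y.

Lemma derivation_nat n : D n%:R = 0.
Proof.
have D1 : D 1 = 0.
  by have := DM 1 1; rewrite !mulr1 mul1r -[LHS]addr0 => /addrI.
by rewrite raddfMn /= D1 mul0rn.
Qed.

Lemma map_derivation_mulmx (m n r : nat) (A : 'M[R]_(m, n)) (B : 'M[R]_(n, r)) :
  map_mx D (A *m B) = map_mx D A *m B + A *m map_mx D B.
Proof.
apply/matrixP => i j; rewrite !mxE raddf_sum -big_split /=.
by apply: eq_bigr => l _; rewrite DM !mxE.
Qed.

Variables (p : nat) (f g a b t : R).
Hypotheses (Df : D f = f * (2%:R * g - f - t) - a)
  (Dg : D g = g * (2%:R * f - g + t) + b)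
  (Da : D a = 0) (Db : D b = 0) (Dt1 : D t = 1).

Lemma derivation_laxC n :
  map_mx D (laxC f g a b t n%:R) =
  laxM f g a b t n.+1%:R *m laxC f g a b t n%:R
  - laxC f g a b t n%:R *m laxM f g a b t n%:R.
Proof.
rewrite /laxC /laxM !map_derivation_mulmx !map_mx2.
rewrite !(raddfB, raddfD, raddfN) -natr1 !derivation_nat raddf0.
(* Constant entries [1] are read as numerals, so that [derivation_nat] kills them. *)
rewrite -[1]/(1%:R) !derivation_nat Df Dg Da Db Dt1.
by rewrite !(mul_mx2, add_mx2, opp_mx2); congr mx2; ring.
Qed.

Lemma derivation_laxTrace : p%:R = 0 :> R -> D (laxTrace p f g a b t) = 0.
Proof.
move=> p0; rewrite laxTraceE //.
have trD (A : 'M[R]_2) : D (\tr A) = \tr (map_mx D A).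
  by rewrite raddf_sum; apply: eq_bigr => i _; rewrite mxE.
set C := fun n => _; pose M n := laxM f g a b t n%:R.
(* The Leibniz terms telescope, leaving only the two end values of [M]. *)
have DC n : map_mx D (dprod C n) = M n * dprod C n - dprod C n * M 0%N.
  elim: n => [|n IHn].
    rewrite dprod0 mulr1 mul1r subrr; apply/matrixP => i j.
    by rewrite !mxE derivation_nat.
  rewrite dprodS -mulmxE map_derivation_mulmx derivation_laxC IHn mulmxE.
  by rewrite mulrBl mulrBr !mulrA addrA subrK.
by rewrite trD DC raddfB /= /M p0 [X in X - _]mxtrace_mulC subrr.
Qed.

End Derivation.

(** * The concrete derivation on the polynomial ring *)

Section PainleveDerivation.
Variable k : fieldType.
Local Notation P := {mpoly k[5]}.

Lemma Dt_zmod_morphism : zmod_morphism (@Dt k).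
Proof.
move=> Q S; rewrite /Dt -sumrB; apply: eq_bigr => i _.
by rewrite raddfB mulrBl.
Qed.

HB.instance Definition _ := GRing.isZmodMorphism.Build P P (@Dt k) Dt_zmod_morphism.

Lemma DtM (Q S : P) : Dt (Q * S) = Dt Q * S + Q * Dt S.
Proof.
rewrite /Dt mulr_suml mulr_sumr -big_split; apply: eq_bigr => i _ /=.
by rewrite mderivM; ring.
Qed.

Lemma DtX i : Dt 'X_i = Dv k i.
Proof.
rewrite /Dt (bigD1 i) //= big1 ?addr0 => [|j ji]; rewrite mderivX mnm1E.
  by rewrite eqxx scale1r -[X in (X - _)%MM]add0m addmK mpolyX0 mul1r.
by rewrite eq_sym (negPf ji) scale0r mul0r.
Qed.

End PainleveDerivation.

(** * Change of coefficients and substitution *)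

Section FromFp.
Variables (k : fieldType) (p : nat).
Hypotheses (p_pr : prime p) (p_char : p \in [pchar k]).

(** Every element of ['F_p] is a numeral, so this reduces the morphism laws of [Fp_to] to those of
    natural number casts. *)
Lemma Fp_to_nat n : Fp_to k (n%:R : 'F_p) = n%:R.
Proof. by rewrite /Fp_to val_Fp_nat // GRing.natr_mod_pchar. Qed.

Lemma Fp_to_nmod_morphism : nmod_morphism (@Fp_to k p).
Proof.
split=> [|x y]; first exact: (Fp_to_nat 0).
by rewrite -[x]natr_Zp -[y]natr_Zp -natrD !Fp_to_nat natrD.
Qed.

Lemma Fp_to_monoid_morphism : monoid_morphism (@Fp_to k p).
Proof.
split=> [|x y]; first exact: (Fp_to_nat 1).
by rewrite -[x]natr_Zp -[y]natr_Zp -natrM !Fp_to_nat natrM.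
Qed.

Lemma map_Ip :
  map_mpoly (@Fp_to k p) (Ip p) =
  laxTrace p 'X_vf 'X_vg 'X_va1 'X_va2 'X_vt :> {mpoly k[5]}.
Proof.
pose phi : {rmorphism 'F_p -> k} := HB.pack (@Fp_to k p)
  (GRing.isNmodMorphism.Build _ _ _ Fp_to_nmod_morphism)
  (GRing.isMonoidMorphism.Build _ _ _ Fp_to_monoid_morphism).
(* [Ip p] is convertible to [laxTrace] at the five variables. *)
rewrite -[LHS]/(map_mpoly phi (laxTrace p 'X_vf 'X_vg 'X_va1 'X_va2 'X_vt)).
by rewrite (rmorph_laxTrace (map_mpoly phi)) /= !(map_mpolyX phi).
Qed.

End FromFp.

Lemma mpoly_natr_eq0 (R : nzRingType) (n p : nat) :
  p \in [pchar R] -> p%:R = 0 :> {mpoly R[n]}.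
Proof. by move=> /pcharf0 p0; rewrite -(rmorph_nat (@mpolyC n R)) p0 rmorph0. Qed.

Section Subst.
Variables (k : fieldType) (p : nat) (v : 'I_5 -> {fraction {mpoly k[5]}}).

Lemma subst_laxTrace :
  subst v (laxTrace p 'X_vf 'X_vg 'X_va1 'X_va2 'X_vt) =
  laxTrace p (v vf) (v vg) (v va1) (v va2) (v vt).
Proof.
pose h : {rmorphism k -> {fraction {mpoly k[5]}}} :=
  [the {rmorphism _ -> _} of @FracField.tofrac _ \o @mpolyC 5 k].
rewrite -[LHS]/(mmap h v _).
by rewrite (rmorph_laxTrace (mmap h v)) /= !mmapX !mmap1U.
Qed.

End Subst.

Lemma meval_neq0 (R : comNzRingType) (n : nat) (v : 'I_n -> R) (Q : {mpoly R[n]}) :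
  Q.@[v] != 0 -> Q != 0.
Proof. by apply: contraNneq => ->; rewrite meval0. Qed.

Lemma mpolyX_neq0 (R : nzRingType) (n : nat) (m : 'X_{1..n}) :
  'X_[m] != 0 :> {mpoly R[n]}.
Proof. by rewrite -msupp_eq0 msuppX. Qed.

(** * Weights of products and traces *)

Section Weights.
Variables (R : comNzRingType) (n : nat) (mf : measure n).
Implicit Types (P Q : {mpoly R[n]}) (d e : nat).

(** [mmeasure] is one more than the weight, and 0 at the zero polynomial, which thus satisfies every
    bound. *)
Definition mle d Q := (mmeasure mf Q <= d.+1)%N.

Lemma mleP d Q : reflect {in msupp Q, forall m, mf m <= d}%N (mle d Q).
Proof.
rewrite /mle mmeasureE; apply: (iffP (bigmax_leqP_seq _ _ _ _)) => Qd m mQ //.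
  exact: Qd.
by move=> _; apply: Qd.
Qed.

Lemma mleW d e Q : mle d Q -> (d <= e)%N -> mle e Q.
Proof. by move=> Qd de; apply: leq_trans Qd _. Qed.

Lemma mle0 d : mle d 0.
Proof. by rewrite /mle mmeasure0. Qed.

Lemma mleD d P Q : mle d P -> mle d Q -> mle d (P + Q).
Proof.
by move=> Pd Qd; apply: leq_trans (mmeasureD_le _ _ _) _; rewrite geq_max; apply/andP.
Qed.

Lemma mleN d Q : mle d (- Q) = mle d Q.
Proof. by rewrite /mle mmeasureN. Qed.

Lemma mleB d P Q : mle d P -> mle d Q -> mle d (P - Q).
Proof. by move=> Pd Qd; apply: mleD; rewrite ?mleN. Qed.

Lemma mleM d e P Q : mle d P -> mle e Q -> mle (d + e) (P * Q).
Proof.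
move=> /mleP Pd /mleP Qe; apply/mleP => m /msuppM_le/allpairsP[[m1 m2] /=].
by case=> /Pd le1 /Qe le2 ->; rewrite mfD leq_add.
Qed.

Lemma mle_nat d c : mle d c%:R.
Proof.
by rewrite -(rmorph_nat (@mpolyC n R)) /mle mmeasureC; case: eqP.
Qed.

Lemma mleX (m : 'X_{1..n}) : mle (mf m) 'X_[m].
Proof. by rewrite /mle mmeasureX. Qed.

Lemma mleXn d e Q : mle d Q -> mle (e * d) (Q ^+ e).
Proof.
move=> Qd; elim: e => [|e IHe]; first exact: (mle_nat _ 1).
by rewrite exprS mulSn; apply: mleM.
Qed.

Lemma mle_sum d (I : finType) (F : I -> {mpoly R[n]}) (S : pred I) :
  (forall i, S i -> mle d (F i)) -> mle d (\sum_(i | S i) F i).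
Proof.
by move=> FSd; apply: (big_ind (mle d)) => //; [apply: mle0 | apply: mleD].
Qed.

Variables (m : nat) (A B : 'I_m.+1 -> nat) (C : nat -> 'M[{mpoly R[n]}]_m.+1).
Hypothesis Cle : forall j i l, mle (A i + B l) (C j i l).

(** Along a path from i to l the ends contribute A_i and B_l, and each of the j interior vertices q
    contributes B_q + A_q. *)
Lemma mle_dprod s : (forall l, (A l + B l <= s)%N) ->
  forall j i l, mle (A i + B l + j * s) (dprod C j.+1 i l).
Proof.
move=> ABs; elim=> [|j IHj] i l.
  by rewrite dprodS dprod0 mulr1 addn0; apply: Cle.
rewrite dprodS -mulmxE mxE; apply: mle_sum => q _.
apply: (mleW (mleM (Cle j.+1 i q) (IHj q l))).
by have := ABs q; lia.
Qed.

(* Among the closed paths of length j+1, only the constant one at l collects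
   the maximal weight s+1 at every step. *)
Lemma dprod_leading s (l : 'I_m.+1) (L : {mpoly R[n]}) :
  (A l + B l = s.+1)%N -> (forall q, q != l -> (A q + B q <= s)%N) ->
  mle s.+1 L -> (forall j, mle s (C j l l - L)) ->
  forall j, mle (s + j * s.+1) (dprod C j.+1 l l - L ^+ j.+1).
Proof.
move=> ABl ABq Ls CL; have ABs q : (A q + B q <= s.+1)%N.
  by have [->|/ABq/leqW//] := eqVneq q l; rewrite ABl.
elim=> [|j IHj]; first by rewrite dprodS dprod0 mulr1 addn0 expr1; apply: CL.
rewrite dprodS -mulmxE mxE (bigD1 l) //= addrAC; apply: mleD; last first.
  apply: mle_sum => q ql.
  apply: (mleW (mleM (Cle j.+1 l q) (mle_dprod ABs j q l))).
  by have := ABq _ ql; lia.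
rewrite exprS.
rewrite (_ : _ - _ = L * (dprod C j.+1 l l - L ^+ j.+1)
                     + (C j.+1 l l - L) * dprod C j.+1 l l); last by ring.
apply: mleD; first by apply: (mleW (mleM Ls IHj)); lia.
by apply: (mleW (mleM (CL j.+1) (mle_dprod ABs j l l))); lia.
Qed.

Lemma mle_trace_dprod s : (forall l, (A l + B l <= s)%N) ->
  forall j, mle (s + j * s) (\tr (dprod C j.+1)).
Proof.
move=> ABs j; apply: mle_sum => l _.
by apply: (mleW (mle_dprod ABs j l l)); rewrite leq_add2r.
Qed.

(** A closed path based at q other than l loses at least one unit of weight at q, so the other
    diagonal entries are negligible. *)
Lemma trace_dprod_leading s (l : 'I_m.+1) (L : {mpoly R[n]}) :
  (A l + B l = s.+1)%N -> (forall q, q != l -> (A q + B q <= s)%N) ->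
  mle s.+1 L -> (forall j, mle s (C j l l - L)) ->
  forall j, mle (s + j * s.+1) (\tr (dprod C j.+1) - L ^+ j.+1).
Proof.
move=> ABl ABq Ls CL j; rewrite /mxtrace (bigD1 l) //= addrAC.
apply: mleD; first exact: dprod_leading.
apply: mle_sum => q ql.
have ABs i : (A i + B i <= s.+1)%N.
  by have [->|/ABq/leqW//] := eqVneq i l; rewrite ABl.
by apply: (mleW (mle_dprod ABs j q q)); rewrite leq_add2r ABq.
Qed.

End Weights.

(** * Degree in one variable as a weight *)

Section Coordinate.
Variables (n : nat) (i : 'I_n).

Definition mcoord (m : 'X_{1..n}) : nat := m i.

Lemma mcoord0 : mcoord 0%MM = 0%N.
Proof. exact: mnm0E. Qed.

Lemma mcoordD : {morph mcoord : m1 m2 / (m1 + m2)%MM >-> (m1 + m2)%N}.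
Proof. by move=> m1 m2; apply: mnmDE. Qed.

HB.instance Definition _ := isMeasure.Build n mcoord mcoord0 mcoordD.

Lemma degvar_le (R : comNzRingType) d (Q : {mpoly R[n]}) :
  mle mcoord d Q -> (degvar i Q <= d)%N.
Proof. by move/mleP => Qd; apply/bigmax_leqP_seq => m /Qd. Qed.

Lemma degvar_ge (R : comNzRingType) m (Q : {mpoly R[n]}) :
  Q@_m != 0 -> (m i <= degvar i Q)%N.
Proof.
by rewrite -mcoeff_msupp => mQ; rewrite /degvar (bigD1_seq m) //= leq_maxl.
Qed.

End Coordinate.

Lemma mle_mcoeff (R : comNzRingType) (n : nat) (mf : measure n) d m
    (Q : {mpoly R[n]}) :
  mle mf d Q -> (d < mf m)%N -> Q@_m = 0.
Proof.
move=> /mleP Qd dm; apply/eqP; rewrite mcoeff_eq0.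
by apply: contraL dm => /Qd; rewrite -leqNgt.
Qed.

(** Infers the weight of a monomial as an existential variable; [mle_poly] then compares it with the
    target bound. *)
Ltac mle_mono :=
  lazymatch goal with
  | |- is_true (mle _ _ (_ * _)) => eapply mleM; mle_mono
  | |- is_true (mle _ _ (_ ^+ _)) => eapply mleXn; mle_mono
  | |- is_true (mle _ _ 'X_[_]) => eapply mleX
  | |- is_true (mle _ _ _%:R) => exact: (@mle_nat _ _ _ 0%N)
  end.

Ltac mle_poly :=
  lazymatch goal with
  | |- is_true (mle _ _ (_ + _)) => apply: mleD; mle_poly
  | |- is_true (mle _ _ (- _)) => rewrite mleN; mle_poly
  | |- _ => eapply mleW; [mle_mono | rewrite /= ?/mcoord ?mdeg1 ?mnm1E //=]
  end.

(** * Degree bounds for the Lax matrix *)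

Section LaxDegrees.
Variables (R : comNzRingType) (j : nat).
Local Notation f := ('X_vf : {mpoly R[5]}).
Local Notation g := ('X_vg : {mpoly R[5]}).
Local Notation a := ('X_va1 : {mpoly R[5]}).
Local Notation b := ('X_va2 : {mpoly R[5]}).
Local Notation t := ('X_vt : {mpoly R[5]}).
Local Notation C := (fun q : nat => laxC f g a b t q%:R).

(** Both diagonal sums A_l + B_l equal 3: no index dominates, and only an upper bound follows. *)
Lemma mle_lax_mdeg (q : nat) (i l : 'I_2) : mle mdeg (i + (3 - l)) (C q i l).
Proof.
rewrite /= laxCE mxE; case: i => [[|[|//]] ?]; case: l => [[|[|//]] ?] /=; mle_poly.
Qed.

(** The sums A_l + B_l are 1 and 2, so the lower right entry dominates. *)
Lemma mle_lax_f (q : nat) (i l : 'I_2) : mle (mcoord vf) (i.+1 + 0) (C q i l).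
Proof.
rewrite /= laxCE mxE; case: i => [[|[|//]] ?]; case: l => [[|[|//]] ?] /=; mle_poly.
Qed.

(** The sums A_l + B_l are 2 and 1, so the upper left entry dominates. *)
Lemma mle_lax_g (q : nat) (i l : 'I_2) : mle (mcoord vg) (0 + (2 - l)) (C q i l).
Proof.
rewrite /= laxCE mxE; case: i => [[|[|//]] ?]; case: l => [[|[|//]] ?] /=; mle_poly.
Qed.

Lemma mle_trace_lax_mdeg : mle mdeg (3 * j.+1) (\tr (dprod C j.+1)).
Proof.
rewrite mulnC mulSn.
apply: (@mle_trace_dprod _ _ _ _ _ (fun l => 3 - l)%N C mle_lax_mdeg) => l.
by case: l => [[|[|//]] ?].
Qed.

Lemma mle_trace_lax_f :
  mle (mcoord vf) (2 * j).+1 (\tr (dprod C j.+1) - (- (f ^+ 2 * g)) ^+ j.+1).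
Proof.
(* The bound takes the form [s + j * s.+1] with [s = 1]. *)
rewrite mulnC -[(j * 2).+1]add1n.
apply: (@trace_dprod_leading _ _ _ _ _ (fun=> 0%N) C mle_lax_f _ ord_max) => //.
- by case=> [[|[|//]] ?].
- mle_poly.
- move=> q; rewrite /= laxCE mxE /= addrAC subrr add0r; mle_poly.
Qed.

Lemma mle_trace_lax_g :
  mle (mcoord vg) (2 * j).+1 (\tr (dprod C j.+1) - (f * g ^+ 2) ^+ j.+1).
Proof.
rewrite mulnC -[(j * 2).+1]add1n.
apply: (@trace_dprod_leading _ _ _ _ (fun=> 0%N) _ C mle_lax_g _ ord0) => //.
- by case=> [[|[|//]] ?].
- mle_poly.
- move=> q; rewrite /= laxCE mxE /= addrAC subrr add0r; mle_poly.
Qed.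

End LaxDegrees.

(** * The integrals of motion *)

Section Integral.
Variables (p : nat) (k : fieldType).
Hypotheses (p_pr : prime p) (p_char : p \in [pchar k]).
Local Notation F := {fraction {mpoly k[5]}}.
Local Notation X i := (('X_i : {mpoly k[5]})%:F : F).
Local Notation Ik := (map_mpoly (@Fp_to k p) (Ip p)).

Lemma tofrac_Ip :
  Ik%:F = laxTrace p (X vf) (X vg) (X va1) (X va2) (X vt).
Proof. by rewrite map_Ip // rmorph_laxTrace. Qed.

Lemma natr_frac_eq0 : p%:R = 0 :> F.
Proof. by rewrite -(rmorph_nat (@FracField.tofrac _)) mpoly_natr_eq0 ?rmorph0. Qed.

Lemma T1_Ip : T1 Ik = Ik%:F.
Proof.
rewrite tofrac_Ip /T1 map_Ip // subst_laxTrace.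
apply: (laxTrace_T1 natr_frac_eq0).
- by rewrite tofrac_eq0 mpolyX_neq0.
- rewrite -tofracM -tofracB tofrac_eq0.
  (* The denominator takes the value 1 where alpha_1 = 1 and the other variables vanish. *)
  apply: (@meval_neq0 _ _ (fun i => (i == va1)%:R)).
  by rewrite mevalB mevalM !mevalXU mulr0 subr0 oner_neq0.
- rewrite -tofrac1 -tofracD tofrac_eq0.
  apply: (@meval_neq0 _ _ (fun _ => 0)).
  by rewrite mevalD mevalXU meval1 add0r oner_neq0.
Qed.

Lemma T2_Ip : T2 Ik = Ik%:F.
Proof.
rewrite tofrac_Ip /T2 map_Ip // subst_laxTrace.
apply: (laxTrace_T2 natr_frac_eq0).
- by rewrite tofrac_eq0 mpolyX_neq0.
- rewrite -tofracM -tofracD tofrac_eq0.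
  apply: (@meval_neq0 _ _ (fun i => (i == va2)%:R)).
  by rewrite mevalD mevalM !mevalXU mulr0 addr0 oner_neq0.
- by rewrite tofrac_eq0 mpolyX_neq0.
Qed.

Lemma Dt_Ip : Dt Ik = 0.
Proof.
rewrite map_Ip //; apply: (derivation_laxTrace (@DtM k)); rewrite /= ?DtX //.
exact: mpoly_natr_eq0.
Qed.

End Integral.

(** * Leading terms and exact degrees *)

Section LeadingTerms.
Variables (p : nat) (p_pr : prime p).
Local Notation P := {mpoly 'F_p[5]}.
Local Notation f := ('X_vf : P).
Local Notation g := ('X_vg : P).

Lemma pchar_mpoly_Fp : p \in [pchar P].
Proof. by rewrite inE p_pr /= mpoly_natr_eq0 ?pchar_Fp. Qed.

Lemma Ip_laxC :
  Ip p = \tr (dprod (fun q => laxC f g 'X_va1 'X_va2 'X_vt q%:R) p).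
Proof. by rewrite -laxTraceE // mpoly_natr_eq0 ?pchar_Fp. Qed.

Lemma Ip_leading_f :
  mle (mcoord vf) (2 * p).-1 (Ip p + f ^+ (2 * p) * g ^+ p).
Proof.
have := mle_trace_lax_f 'F_p p.-1; rewrite prednK ?prime_gt0 // -Ip_laxC.
(* Additivity of Frobenius gives the sign uniformly, including p = 2. *)
have -> : (- (f ^+ 2 * g)) ^+ p = - (f ^+ (2 * p) * g ^+ p).
  by rewrite -!(GRing.pFrobenius_autE pchar_mpoly_Fp) GRing.pFrobenius_autN
             !GRing.pFrobenius_autE exprMn exprM.
by rewrite opprK => /mleW; apply; have := prime_gt0 p_pr; lia.
Qed.

Lemma Ip_leading_g :
  mle (mcoord vg) (2 * p).-1 (Ip p - f ^+ p * g ^+ (2 * p)).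
Proof.
have := mle_trace_lax_g 'F_p p.-1; rewrite prednK ?prime_gt0 // -Ip_laxC.
by rewrite exprMn -exprM => /mleW; apply; have := prime_gt0 p_pr; lia.
Qed.

Lemma mle_Ip : mle mdeg (3 * p) (Ip p).
Proof.
by rewrite Ip_laxC -(prednK (prime_gt0 p_pr)); apply: mle_trace_lax_mdeg.
Qed.

Local Notation mfg i j := (U_(vf) *+ i + U_(vg) *+ j)%MM.

Lemma XfXg i j : f ^+ i * g ^+ j = 'X_[mfg i j].
Proof. by rewrite mpolyXD !mpolyXn. Qed.

Lemma mfg_f i j : mfg i j vf = i.
Proof. by rewrite mnmDE !mulmnE !mnm1E /= mul1n addn0. Qed.

Lemma mfg_g i j : mfg i j vg = j.
Proof. by rewrite mnmDE !mulmnE !mnm1E /= mul1n. Qed.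

(** This monomial has degree 2p in f, beyond the reach of the remainder. *)
Lemma Ip_coeff_f : (Ip p)@_(mfg (2 * p) p) = -1.
Proof.
have /mle_mcoeff/(_ _) := Ip_leading_f; move/(_ (mfg (2 * p) p)).
rewrite /= /mcoord mfg_f XfXg mcoeffD mcoeffX eqxx => Ip0; apply/eqP.
by rewrite -addr_eq0 Ip0 //; have := prime_gt0 p_pr; lia.
Qed.

Lemma Ip_coeff_g : (Ip p)@_(mfg p (2 * p)) = 1.
Proof.
have /mle_mcoeff/(_ _) := Ip_leading_g; move/(_ (mfg p (2 * p))).
rewrite /= /mcoord mfg_g XfXg mcoeffB mcoeffX eqxx => Ip0; apply/eqP.
by rewrite -subr_eq0 Ip0 //; have := prime_gt0 p_pr; lia.
Qed.

Lemma msize_Ip : msize (Ip p) = (3 * p).+1.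
Proof.
apply/eqP; rewrite eqn_leq; apply/andP; split; first exact: mle_Ip.
(* The monomial f^(2p) g^p attains the total degree 3p. *)
have : mfg (2 * p) p \in msupp (Ip p).
  by rewrite mcoeff_msupp Ip_coeff_f oppr_eq0 oner_neq0.
move/msize_mdeg_lt; rewrite mdegD !mdegMn !mdeg1; lia.
Qed.

Lemma degvar_f_Ip : degvar vf (Ip p) = (2 * p)%N.
Proof.
apply/eqP; rewrite eqn_leq; apply/andP; split; last first.
  rewrite -{1}(mfg_f (2 * p) p); apply: degvar_ge.
  by rewrite Ip_coeff_f oppr_eq0 oner_neq0.
apply: degvar_le; rewrite -[Ip p](addrK (f ^+ (2 * p) * g ^+ p)).
apply: mleB; first by apply: (mleW Ip_leading_f); lia.
by rewrite XfXg; apply: (mleW (mleX _ _ _)); rewrite /= /mcoord mfg_f.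
Qed.

Lemma degvar_g_Ip : degvar vg (Ip p) = (2 * p)%N.
Proof.
apply/eqP; rewrite eqn_leq; apply/andP; split; last first.
  rewrite -{1}(mfg_g p (2 * p)); apply: degvar_ge.
  by rewrite Ip_coeff_g oner_neq0.
apply: degvar_le; rewrite -[Ip p](subrK (f ^+ p * g ^+ (2 * p))).
apply: mleD; first by apply: (mleW Ip_leading_g); lia.
by rewrite XfXg; apply: (mleW (mleX _ _ _)); rewrite /= /mcoord mfg_g.
Qed.

(** In each variable one leading term cancels the top degree and the other has degree only p <
    2p. *)
Lemma Ip_remainder :
  let O := Ip p + f ^+ (2 * p) * g ^+ p - f ^+ p * g ^+ (2 * p) in
  (degvar vf O < 2 * p)%N /\ (degvar vg O < 2 * p)%N.
Proof.
have p_gt0 := prime_gt0 p_pr.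
have p2 : (2 * p = (2 * p).-1.+1)%N by lia.
split; rewrite [X in (_ < X)%N]p2 ltnS; apply: degvar_le; last rewrite addrAC.
  apply: mleB; first exact: Ip_leading_f.
  by rewrite XfXg; apply: (mleW (mleX _ _ _)); rewrite /= /mcoord mfg_f; lia.
apply: mleD; first exact: Ip_leading_g.
by rewrite XfXg; apply: (mleW (mleX _ _ _)); rewrite /= /mcoord mfg_g; lia.
Qed.

End LeadingTerms.

Unset Implicit Arguments.

Theorem theorem2p2 (p : nat) (k : fieldType) :
  prime p -> p \in [pchar k] ->
  let Ik := map_mpoly (@Fp_to k p) (Ip p) in
  [/\ T1 Ik = Ik%:F, T2 Ik = Ik%:F & Dt Ik = 0] /\
  [/\ msize (Ip p) = (3 * p).+1,
      degvar vf (Ip p) = (2 * p)%N, degvar vg (Ip p) = (2 * p)%N &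
      exists O : {mpoly 'F_p[5]},
        [/\ Ip p = - ('X_vf ^+ (2 * p) * 'X_vg ^+ p) + 'X_vf ^+ p * 'X_vg ^+ (2 * p) + O,
            (degvar vf O < 2 * p)%N & (degvar vg O < 2 * p)%N]].
Proof.
move=> p_pr p_char; split.
  by split; [apply: T1_Ip | apply: T2_Ip | apply: Dt_Ip].
split; [exact: msize_Ip | exact: degvar_f_Ip | exact: degvar_g_Ip |].
have [Of Og] := Ip_remainder p_pr.
by exists (Ip p + 'X_vf ^+ (2 * p) * 'X_vg ^+ p - 'X_vf ^+ p * 'X_vg ^+ (2 * p));
  split=> //; ring.
Qed.
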